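(* Suppose $(x^*,u^*,y^* )$ is a P-stationary triplet of the problem (P), and suppose the second-order sufficient condition holds: $$d^\top\nabla^2 f(x^* )\,d>0\qquad\text{for all } d\in\mathcal C^*\setminus\{0\}.$$ Then $(x^*,u^* )$ is a strict local solution of (P). Furthermore, there exist constants $\delta^*>0$ and $c^*>0$ such that the following quadratic growth condition holds: $$f(x)+\lambda\|u_+\|_0\ \ge\ f(x^* )+\lambda\|u^*_+\|_0+c^*\|(x,u)-(x^*,u^* )\|^2\qquad\text{for all }(x,u)\in\mathcal N((x^*,u^* ),\delta^* )\cap\mathcal F.$$
   Context: $[m]=\{1,\dots,m\}$; for $T\subseteq[m]$, $A_T$ is the submatrix of $A$ formed by the rows indexed by $T$; $\mathcal N(z,\delta)$ is the open Euclidean ball of radius $\delta$ centred at $z$. $f:\mathbb{R}^n\to\mathbb{R}$ is twice continuously differentiable, $\lambda>0$, $A\in\mathbb{R}^{m\times n}$, $b\in\mathbb{R}^m$, and $h(u):=\|u_+\|_0$ is the number of strictly positive entries of $u\in\mathbb{R}^m$. Problem (P): $\min_{x\in\mathbb{R}^n,u\in\mathbb{R}^m} f(x)+\lambda h(u)$ subject to $Ax+b=u$; its feasible set is $\mathcal F:=\{(x,u): Ax+b=u\}$. For $\alpha>0$, $\mathrm{Prox}_{\alpha\lambda h(\cdot)}(v):=\arg\min_{z\in\mathbb{R}^m}\{\alpha\lambda h(z)+\tfrac12\|z-v\|^2\}$ (set-valued). $(x,u,y)$ is a P-stationary triplet of (P) if there exists $\alpha>0$ such that $\nabla f(x)+A^\top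 y=0$, $u\in\mathrm{Prox}_{\alpha\lambda h(\cdot)}(u+\alpha y)$, and $Ax+b-u=0$. Index sets at $(x^*,u^*,y^* )$: $\mathcal I_0^*:=\{i\in[m]: u_i^*=0,\ y_i^*=0\}$ and $\mathcal I_+^*:=\{i\in[m]: u_i^*=0,\ y_i^*>0\}$. Cone: $\mathcal C^*:=\{d\in\mathbb{R}^n : A_{\mathcal I_+^*}d=0,\ A_{\mathcal I_0^*}d\le 0\}$. *)

(* Defs.v *)
From HB Require Import structures.
From mathcomp Require Import all_boot all_order all_algebra.
From mathcomp Require Import all_classical all_reals all_analysis.

Set Implicit Arguments.
Unset Strict Implicit.
Unset Printing Implicit Defensive.

Import Order.TTheory GRing.Theory Num.Theory.
Import numFieldNormedType.Exports.

Local Open Scope classical_set_scope.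
Local Open Scope ring_scope.

(* MathComp-Analysis development.  R^k is ['cV[R]_k].  The norm [`|_|] that the
   library puts on matrices and on pairs is the sup norm; it only serves to
   define limits and differentials, and every metric quantity below is stated
   with the Euclidean norms [enorm] and [pnorm]. *)

Section Euclidean.
Context {R : realType}.

Definition enorm (k : nat) (v : 'cV[R]_k) : R :=
  Num.sqrt (\sum_(i < k) v i 0 ^+ 2).

Definition pnorm (n m : nat) (z : 'cV[R]_n * 'cV[R]_m) : R :=
  enorm (col_mx z.1 z.2).

Definition pball (n m : nat) (z : 'cV[R]_n * 'cV[R]_m) (delta : R) :
    set ('cV[R]_n * 'cV[R]_m) :=
  [set w | pnorm (w - z) < delta].

End Euclidean.

Section SecondOrderCalculus.
Context {R : realType} {n : nat}.
Implicit Types (f : 'cV[R]_n -> R) (x : 'cV[R]_n).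

Definition gradient f x : 'cV[R]_n := \col_i 'D_(delta_mx i 0) f x.

Definition hessian f x : 'M[R]_n :=
  \matrix_(i, j) 'D_(delta_mx j 0) (fun z => gradient f z i 0) x.

(* [differentiable] is Frechet differentiability; the derivative of [f] is
   identified with its gradient, and the second derivative with the Hessian. *)
Definition twice_continuously_differentiable f : Prop :=
  [/\ forall x, differentiable f x,
      forall x, differentiable (gradient f) x
    & continuous (hessian f)].

End SecondOrderCalculus.

Section Proximal.
Context {R : realType} {m : nat}.
Implicit Types (u v : 'cV[R]_m) (g : 'cV[R]_m -> R).

Definition pos_part u : 'cV[R]_m := \col_i Num.max (u i 0) 0.

Definition l0norm v : nat := #|[pred i | v i 0 != 0]|.

Definition h u : R := (l0norm (pos_part u))%:R.

Definition argmin (T : Type) (F : T -> R) : set T :=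
  [set z | forall w, F z <= F w].

Definition prox g v : set 'cV[R]_m :=
  argmin (fun z => g z + 2^-1 * enorm (z - v) ^+ 2).

End Proximal.

Section Problem.
Context {R : realType} {n m : nat}.
Variables (f : 'cV[R]_n -> R) (lambda : R) (A : 'M[R]_(m, n)) (b : 'cV[R]_m).
Implicit Types (x d : 'cV[R]_n) (u y : 'cV[R]_m) (z : 'cV[R]_n * 'cV[R]_m).

Definition objective z : R := f z.1 + lambda * h z.2.

Definition feasible : set ('cV[R]_n * 'cV[R]_m) :=
  [set z | A *m z.1 + b = z.2].

Definition strict_local_solution z : Prop :=
  feasible z /\
  exists2 delta : R, 0 < delta &
    forall w, (pball z delta `&` feasible) w -> w != z ->
      objective z < objective w.

Definition P_stationary x u y : Prop :=
  exists2 alpha : R, 0 < alpha &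
    [/\ gradient f x + A^T *m y = 0,
        prox (fun v => alpha * lambda * h v) (u + alpha *: y) u
      & A *m x + b - u = 0].

End Problem.

Section CriticalCone.
Context {R : realType} {n m : nat}.
Implicit Types (A : 'M[R]_(m, n)) (u y : 'cV[R]_m).

Definition row_submatrix A (T : {set 'I_m}) : 'M[R]_(#|T|, n) :=
  rowsub (fun k : 'I_#|T| => enum_val k) A.

Definition index0 u y : {set 'I_m} :=
  [set i | (u i 0 == 0) && (y i 0 == 0)]%SET.

Definition indexp u y : {set 'I_m} :=
  [set i | (u i 0 == 0) && (0 < y i 0)]%SET.

Definition critical_cone A u y : set 'cV[R]_n :=
  [set d | row_submatrix A (indexp u y) *m d = 0 /\
    forall k, (row_submatrix A (index0 u y) *m d) k 0 <= 0].

End CriticalCone.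

(* Main.v *)
Require Import Defs.
From HB Require Import structures.
From mathcomp Require Import all_boot all_order all_algebra.
From mathcomp Require Import all_classical all_reals all_analysis.
From mathcomp Require Import ring lra.

Set Implicit Arguments.
Unset Strict Implicit.
Unset Printing Implicit Defensive.

Import Order.TTheory GRing.Theory Num.Theory.
Import numFieldNormedType.Exports.

Local Open Scope classical_set_scope.
Local Open Scope ring_scope.

(** Write [d := x - xs], so that [u - us = A d] on the feasible set, and let
    [a] and [H] be the gradient and the Hessian of [f] at [xs].  The proximal
    condition says that [ys >= 0] where [us = 0] and [ys = 0] elsewhere.  Near
    [us] the integer [h] cannot decrease.  If it increases, the objective gains
    [lambda], which beats the continuous variation of [f].  Otherwise [d] lies
    in the cone [K] where [(A d)_i <= 0] whenever [us_i = 0].  On [K] we have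
    [a . d = - ys . (A d) >= 0], with equality only on the critical cone, so by
    compactness of the unit sphere of [K], [d . H d + M |d| (a . d)] is at least
    [c |d|^2] for some [c, M > 0].  For [M |d| <= 2] this makes the second-order
    Taylor polynomial [a . d + 1/2 d . H d] at least [c/2 |d|^2]. *)

Section ColumnVectors.
Context {R : realType}.

Definition dot (n : nat) (a d : 'cV[R]_n) : R := (a^T *m d) 0 0.

Lemma dotE (n : nat) (a d : 'cV[R]_n) : dot a d = \sum_(i < n) a i 0 * d i 0.
Proof. by rewrite /dot mxE; apply: eq_bigr => i _; rewrite mxE. Qed.

Lemma dotBl (n : nat) (a a' d : 'cV[R]_n) : dot (a - a') d = dot a d - dot a' d.
Proof. by rewrite /dot linearB /= mulmxBl !mxE. Qed.

Lemma dotZl (n : nat) (k : R) (a d : 'cV[R]_n) : dot (k *: a) d = k * dot a d.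
Proof. by rewrite /dot linearZ /= -scalemxAl mxE. Qed.

Lemma dotZr (n : nat) (k : R) (a d : 'cV[R]_n) : dot a (k *: d) = k * dot a d.
Proof. by rewrite /dot -scalemxAr mxE. Qed.

Lemma dotC (n : nat) (a d : 'cV[R]_n) : dot a d = dot d a.
Proof. by rewrite !dotE; apply: eq_bigr => i _; rewrite mulrC. Qed.

Lemma dot_row (m n : nat) (A : 'M[R]_(m, n)) (d : 'cV[R]_n) (i : 'I_m) :
  dot (row i A)^T d = (A *m d) i 0.
Proof. by rewrite /dot trmxK -row_mul mxE. Qed.

Lemma coord_le_norm (n : nat) (x : 'cV[R]_n) (i : 'I_n) : `|x i 0| <= `|x|.
Proof.
rewrite [leRHS]/Num.Def.normr /= mx_normrE; apply/bigmax_geP; right => /=.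
by exists (i, 0).
Qed.

Lemma norm_le_coord (n : nat) (x : 'cV[R]_n) (c : R) :
  0 <= c -> (forall i, `|x i 0| <= c) -> `|x| <= c.
Proof.
move=> c0 xc; rewrite [leLHS]/Num.Def.normr /= mx_normrE; apply/bigmax_leP.
by split=> // -[i j] _ /=; rewrite ord1.
Qed.

Lemma dot_le_norm (n : nat) (a d : 'cV[R]_n) :
  `|dot a d| <= n%:R * (`|a| * `|d|).
Proof.
rewrite dotE (le_trans (ler_norm_sum _ _ _))//.
have -> : n%:R * (`|a| * `|d|) = \sum_(i < n) `|a| * `|d|.
  by rewrite sumr_const card_ord mulr_natl.
rewrite ler_sum// => i _.
by rewrite normrM ler_pM// coord_le_norm.
Qed.

Lemma mulmx_le_norm (m n : nat) (A : 'M[R]_(m, n)) :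
  exists2 C : R, 0 <= C & forall d : 'cV[R]_n, `|A *m d| <= C * `|d|.
Proof.
exists (n%:R * \sum_(i < m) `|(row i A)^T|).
  by apply: mulr_ge0 => //; apply: sumr_ge0.
move=> d; apply: norm_le_coord => [|i].
  by apply: mulr_ge0 => //; apply: mulr_ge0 => //; apply: sumr_ge0.
rewrite -dot_row (le_trans (dot_le_norm _ _))// -mulrA ler_wpM2l// ler_wpM2r//.
by rewrite (bigD1 i)//= lerDl sumr_ge0.
Qed.

Lemma sqr_pnorm (n m : nat) (z : 'cV[R]_n * 'cV[R]_m) :
  pnorm z ^+ 2 = dot z.1 z.1 + dot z.2 z.2.
Proof.
rewrite /pnorm /enorm sqr_sqrtr.
  2: by rewrite sumr_ge0// => i _; exact: sqr_ge0.
rewrite big_split_ord /= !dotE; congr (_ + _); apply: eq_bigr => i _.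
  by rewrite col_mxEu expr2.
by rewrite col_mxEd expr2.
Qed.

Lemma sqr_coord_le_dot (n : nat) (x : 'cV[R]_n) (i : 'I_n) :
  x i 0 ^+ 2 <= dot x x.
Proof.
rewrite dotE (bigD1 i)//= -expr2 lerDl sumr_ge0// => j _.
by rewrite -expr2 sqr_ge0.
Qed.

Lemma dot_ge0 (n : nat) (x : 'cV[R]_n) : 0 <= dot x x.
Proof. by rewrite dotE sumr_ge0// => j _; rewrite -expr2 sqr_ge0. Qed.

Lemma pnorm_ge0 (n m : nat) (z : 'cV[R]_n * 'cV[R]_m) : 0 <= pnorm z.
Proof. exact: sqrtr_ge0. Qed.

Lemma norm_le_pnorm (n m : nat) (z : 'cV[R]_n * 'cV[R]_m) :
  `|z.1| <= pnorm z /\ `|z.2| <= pnorm z.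
Proof.
split; apply: norm_le_coord => [|i]; rewrite ?pnorm_ge0//.
  rewrite -ler_sqr ?nnegrE ?pnorm_ge0// real_normK ?num_real// sqr_pnorm.
  by rewrite (le_trans (sqr_coord_le_dot _ i))// lerDl dot_ge0.
rewrite -ler_sqr ?nnegrE ?pnorm_ge0// real_normK ?num_real// sqr_pnorm.
by rewrite (le_trans (sqr_coord_le_dot _ i))// lerDr dot_ge0.
Qed.

Lemma pnorm_gt0 (n m : nat) (z : 'cV[R]_n * 'cV[R]_m) : z != 0 -> 0 < pnorm z.
Proof.
rewrite lt0r pnorm_ge0 andbT; apply: contra => /eqP z0.
have [] := norm_le_pnorm z; rewrite z0; case: z z0 => x u _ /=.
by rewrite !normr_le0 => /eqP-> /eqP->.
Qed.

Lemma continuous_sumr (T : topologicalType) (I : Type) (s : seq I)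
    (F : I -> T -> R) :
  (forall i, continuous (F i)) -> continuous (fun x => \sum_(i <- s) F i x).
Proof.
move=> cF x; elim: s => [|i s IH].
  have -> : (fun y => \sum_(i <- [::]) F i y) = cst 0.
    by apply/funext => y; rewrite big_nil.
  exact: cst_continuous.
have -> : (fun y => \sum_(j <- i :: s) F j y) =
    F i \+ (fun y => \sum_(j <- s) F j y).
  by apply/funext => y; rewrite big_cons.
by apply: continuousD => //; exact: cF.
Qed.

Lemma dot_continuous (n : nat) (a : 'cV[R]_n) : continuous (dot a).
Proof.
have -> : dot a = (fun d => \sum_(i < n) a i 0 * d i 0).
  by apply/funext => d; rewrite dotE.
apply: continuous_sumr => i d; apply: continuousM; first exact: cst_continuous.
exact: coord_continuous.
Qed.

Lemma quadratic_continuous (n : nat) (H : 'M[R]_n) :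
  continuous (fun d : 'cV[R]_n => dot d (H *m d)).
Proof.
have -> : (fun d : 'cV[R]_n => dot d (H *m d)) =
    (fun d => \sum_(i < n) d i 0 * dot (row i H)^T d).
  apply/funext => d; rewrite dotE; apply: eq_bigr => i _.
  by rewrite dot_row.
apply: continuous_sumr => i d.
by apply: continuousM; [exact: coord_continuous|exact: dot_continuous].
Qed.

Lemma cV_bounded_closed_compact (n : nat) (B : set 'cV[R]_n) :
  bounded_set B -> closed B -> compact B.
Proof.
have tr_cont (p q : nat) : continuous (@trmx R p q).
  move=> M s /= /nbhs_ballP[e e0 es].
  apply/nbhs_ballP; exists e => //= N [_ MN].
  by apply: es; split => // i j; rewrite !mxE; exact: MN.
move=> bB cB.
have -> : B = @trmx R 1 n @` [set v | B v^T].
  apply/seteqP; split=> [x Bx|_ [v Bv <-]//].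
  by exists x^T; rewrite /= trmxK.
apply: continuous_compact.
  by apply: continuous_subspaceT => x; exact: tr_cont.
apply: bounded_closed_compact; last first.
  by apply: closed_comp => // x _; exact: tr_cont.
case: bB => M [Mr MB]; exists (Num.max M 0); split; first exact: num_real.
move=> N; rewrite gt_max => /andP[MN N0] v /= /(MB _ MN) vN.
rewrite [leLHS]/Num.Def.normr /= mx_normrE; apply/bigmax_leP.
split; first exact: ltW.
move=> [i j] _ /=; rewrite (le_trans _ vN)//.
by have := coord_le_norm v^T j; rewrite mxE ord1.
Qed.

End ColumnVectors.

Section SecondOrderTaylor.
Context {R : realType} {n : nat}.
Implicit Types (f : 'cV[R]_n -> R) (x d : 'cV[R]_n).

Lemma cV_sum_delta d : d = \sum_(i < n) d i 0 *: delta_mx i 0.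
Proof.
rewrite [LHS]matrix_sum_delta; apply: eq_bigr => i _.
by rewrite big_ord1.
Qed.

Lemma derive_gradient f x d :
  differentiable f x -> 'D_d f x = dot (gradient f x) d.
Proof.
move=> df; rewrite deriveE// [in LHS](cV_sum_delta d) linear_sum dotE.
by apply: eq_bigr => i _; rewrite linearZ /= mxE deriveE// mulrC.
Qed.

Lemma derive_hessian f x d :
  differentiable (gradient f) x -> 'D_d (gradient f) x = hessian f x *m d.
Proof.
move=> dg; rewrite deriveE// [in LHS](cV_sum_delta d) linear_sum.
apply/colP => i; rewrite summxE mxE; apply: eq_bigr => j _.
rewrite linearZ /= !mxE -deriveE// derive_mx ?mxE 1?mulrC//.
exact: diff_derivable.
Qed.

Lemma differentiable_expansion (m : nat) (g : 'cV[R]_n -> 'cV[R]_m) x (e : R) :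
  differentiable g x -> 0 < e ->
  exists2 delta : R, 0 < delta & forall d, `|d| < delta ->
    `|g (x + d) - g x - 'D_d g x| <= e * `|d|.
Proof.
move=> dg e0; have := diff_locally dg => /eqaddoP.
move=> /(_ e e0) /nbhs_normP[delta /= d0 H].
exists delta => // d dd; have := H d; rewrite /= sub0r normrN => /(_ dd).
by rewrite deriveE// !fctE /= opprD addrA [d + x]addrC.
Qed.

Lemma is_derive_along f x d (t : R) :
  differentiable f (x + t *: d) ->
  is_derive t 1 (fun s => f (x + s *: d)) ('D_d f (x + t *: d)).
Proof.
move=> df; have dfd : derivable f (x + t *: d) d by exact: diff_derivable.
have E : (fun h : R => h^-1 *: ((fun s => f (x + s *: d)) (h *: 1 + t)
    - f (x + t *: d))) =
  (fun h : R => h^-1 *: ((f \o shift (x + t *: d)) (h *: d) - f (x + t *: d))).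
  apply/funext => h; congr (_ *: (f _ - _)).
  by rewrite /= [h%:A]mulr1 scalerDl addrCA.
by split; [rewrite /derivable /= E|rewrite /derive /= E].
Qed.

(* Mean value theorem for the remainder along the segment [x, x + d]. *)
Lemma taylor2 f x (e : R) :
  (forall z, differentiable f z) -> differentiable (gradient f) x -> 0 < e ->
  exists2 delta : R, 0 < delta & forall d, `|d| < delta ->
    `|f (x + d) - f x - dot (gradient f x) d - 2^-1 * dot d (hessian f x *m d)|
      <= e * `|d| ^+ 2.
Proof.
move=> df dg e0; have e'0 : 0 < e / (n%:R + 1) by rewrite divr_gt0// ltr_wpDl.
have [delta delta0 H] := differentiable_expansion dg e'0.
exists delta => // d dd.
set a := dot (gradient f x) d; set q := dot d _.
pose F (t : R) := f (x + t *: d) - a * t - 2^-1 * q * t ^+ 2.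
pose dF (t : R) := dot (gradient f (x + t *: d)) d - a - q * t.
have derF (t : R) : is_derive t 1 F (dF t).
  have D := is_derive_along (df (x + t *: d)).
  have DF := is_deriveB (is_deriveB D (is_deriveZ a (is_derive_id t 1)))
    (is_deriveZ (2^-1 * q) (is_deriveX 2 (is_derive_id t 1))).
  have -> : F = (fun s => f (x + s *: d)) - a \*: id - (2^-1 * q) \*: id ^+ 2.
    by apply/funext => s; rewrite !fctE.
  apply: (@is_derive_eq _ _ _ _ _ _ _ _ DF).
  rewrite derive_gradient// /dF /= expr1 /GRing.scale /=.
  by field.
have [c c01] : exists2 c : R, c \in `]0, 1[%R & F 1 - F 0 = dF c * (1 - 0).
  apply: MVT; first exact: ltr01.
  apply: continuous_subspaceT => t.
  apply: differentiable_continuous; apply/derivable1_diffP.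
  by case: (derF t).
rewrite subr0 mulr1 /F !scale1r scale0r addr0 !mulr0 expr0n /= mulr0 !subr0.
rewrite mulr1 expr1n mulr1 => FE.
have -> : f (x + d) - f x - a - 2^-1 * q = dF c by rewrite -FE; ring.
have {c01}[c0 c1] : 0 <= c /\ c <= 1.
  by move: c01; rewrite in_itv /= => /andP[/ltW ? /ltW].
have cd : `|c *: d| <= `|d| by rewrite normrZ ger0_norm// ler_piMl.
have -> : dF c =
    dot (gradient f (x + c *: d) - gradient f x - hessian f x *m (c *: d)) d.
  rewrite /dF -scalemxAr !dotBl dotZl [dot (_ *m _) _]dotC mulrC.
  by [].
apply: (le_trans (dot_le_norm _ _)).
have := H _ (le_lt_trans cd dd); rewrite derive_hessian// => {}H.
apply: (@le_trans _ _ (n%:R * (e / (n%:R + 1) * `|d| * `|d|))).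
  rewrite ler_wpM2l// ler_wpM2r// (le_trans H)// ler_wpM2l//.
  exact: ltW.
rewrite expr2 !mulrA ler_wpM2r// ler_wpM2r// -mulrA mulrCA ler_piMr ?ltW//.
by rewrite ltr_pdivrMr ?mul1r ?ltrDl ?ltr_wpDl//.
Qed.

End SecondOrderTaylor.

Section Compactness.
Context {R : realType}.

(* The penalty works because [max q g] is bounded below by a positive constant
   on [S]. *)
Lemma compact_penalization (T : topologicalType) (S : set T) (q g : T -> R) :
  compact S -> continuous q -> continuous g ->
  (forall x, S x -> 0 <= g x) -> (forall x, S x -> g x = 0 -> 0 < q x) ->
  exists c M : R, [/\ 0 < c, 0 < M & forall x, S x -> c <= q x + M * g x].
Proof.
move=> cS cq cg g0 gq.
have [->|/set0P S0] := eqVneq S set0; first by exists 1, 1; split.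
have cr : continuous (fun x => Num.max (q x) (g x)).
  by move=> x; apply: continuous_max; [exact: cq|exact: cg].
have [x0 /set_mem Sx0 r_min] :=
  compact_EVT_min S0 cS (continuous_subspaceT cr).
have [x1 _ q_min] := compact_EVT_min S0 cS (continuous_subspaceT cq).
set c := Num.max (q x0) (g x0) in r_min.
have c0 : 0 < c.
  rewrite lt_max; have := g0 _ Sx0; rewrite le_eqVlt => /orP[/eqP/esym|->].
    by move=> /(gq _ Sx0) ->.
  by rewrite orbT.
exists c, ((`|q x1| + c) / c); split=> //.
  by rewrite divr_gt0// ltr_wpDl.
move=> x Sx; have := r_min x (mem_set Sx); rewrite le_max => /orP[cqx|cgx].
  by rewrite (le_trans cqx)// lerDl mulr_ge0 ?g0// divr_ge0 ?addr_ge0// ltW.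
have : `|q x1| + c <= (`|q x1| + c) / c * g x.
  by rewrite -mulrA ler_peMr ?addr_ge0 ?(ltW c0)// mulrC ler_pdivlMr// mul1r.
have := q_min x (mem_set Sx); have := ler_norm (- q x1); rewrite normrN.
lra.
Qed.

Lemma cone_penalization (n : nat) (K : set 'cV[R]_n) (H : 'M[R]_n)
    (a : 'cV[R]_n) :
  closed K -> (forall (k : R) d, 0 < k -> K d -> K (k *: d)) ->
  (forall d, K d -> 0 <= dot a d) ->
  (forall d, K d -> d != 0 -> dot a d = 0 -> 0 < dot d (H *m d)) ->
  exists c M : R, [/\ 0 < c, 0 < M &
    forall d, K d -> c * `|d| ^+ 2 <= dot d (H *m d) + M * `|d| * dot a d].
Proof.
move=> clK coneK a0 aH.
pose S := K `&` [set d : 'cV[R]_n | `|d| = 1].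
have cS : compact S.
  apply: cV_bounded_closed_compact.
    exists 1; split; first exact: num_real.
    by move=> N N1 d [_ /= ->]; exact: ltW.
  apply: closedI => //.
  apply: (@closed_comp _ _ (fun d : 'cV[R]_n => `|d|) [set 1]).
    by move=> d _; exact: norm_continuous.
  exact: closed_eq.
have [|d [Kd d1] ad0|c [M [c0 M0 HcM]]] := compact_penalization cS
   (@quadratic_continuous R n H) (@dot_continuous R n a).
- by move=> d [/a0].
- by apply: aH => //; rewrite -normr_eq0 d1 oner_eq0.
exists c, M; split=> // d Kd.
have [->|d0] := eqVneq d 0.
  by rewrite normr0 expr0n /= mulr0 mulr0 mul0r addr0 /dot mulmx0 mulmx0 mxE.
have nd0 : 0 < `|d| by rewrite normr_gt0.
have := HcM (`|d|^-1 *: d).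
rewrite -scalemxAr !(dotZl, dotZr).
have S1 : S (`|d|^-1 *: d).
  split; first by apply: coneK => //; rewrite invr_gt0.
  by rewrite /= normrZ normfV normr_id mulVf// gt_eqF.
move=> /(_ S1); rewrite -(ler_pM2r (exprn_gt0 2 nd0)) => /le_trans; apply.
rewrite le_eqVlt; apply/orP; left; apply/eqP; field.
by rewrite gt_eqF.
Qed.

Lemma polyhedral_cone_closed (m n : nat) (A : 'M[R]_(m, n)) (P : pred 'I_m) :
  closed [set d : 'cV[R]_n | forall i, P i -> (A *m d) i 0 <= 0].
Proof.
have -> : [set d : 'cV[R]_n | forall i, P i -> (A *m d) i 0 <= 0] =
    \bigcap_(i in [set i | P i]) (dot (row i A)^T @^-1` [set x | x <= 0]).
  apply/seteqP; split=> d /= Hd i /Hd; by rewrite /= dot_row.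
apply: closed_bigI => i _; apply: closed_comp; last exact: closed_le.
by move=> d _; exact: dot_continuous.
Qed.

End Compactness.

Section ProximalMultiplier.
Context {R : realType} {m : nat}.
Implicit Types u v y : 'cV[R]_m.

Lemma hE u : h u = #|[pred i | 0 < u i 0]|%:R :> R.
Proof.
rewrite /h /l0norm; congr _%:R; apply: eq_card => i.
by rewrite !inE mxE; case: ltrP => ui; rewrite ?eqxx// gt_eqF.
Qed.

Definition set_coord u (i : 'I_m) (t : R) : 'cV[R]_m :=
  \col_j if j == i then t else u j 0.

(* Moving only coordinate [i] without changing its positivity leaves [h]
   unchanged, so only the quadratic term of the proximal objective varies. *)
Lemma prox_coord (c alpha : R) u y (i : 'I_m) (t : R) :
  prox (fun v => c * h v) (u + alpha *: y) u ->
  (0 < t) = (0 < u i 0) ->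
  (alpha * y i 0) ^+ 2 <= (t - (u i 0 + alpha * y i 0)) ^+ 2.
Proof.
move=> /(_ (set_coord u i t)) /= + tu.
have -> : h (set_coord u i t) = h u.
  rewrite !hE; congr _%:R; apply: eq_card => j.
  by rewrite !inE mxE; case: eqP => // ->.
rewrite lerD2l ler_pM2l ?invr_gt0// /enorm !sqr_sqrtr; last 2 first.
- by apply: sumr_ge0 => j _; exact: sqr_ge0.
- by apply: sumr_ge0 => j _; exact: sqr_ge0.
rewrite (bigD1 i)//= [leRHS](bigD1 i)//=.
rewrite [X in _ + X <= _](_ : _ =
  \sum_(j < m | j != i) (set_coord u i t - (u + alpha *: y)) j 0 ^+ 2).
  rewrite lerD2r !mxE eqxx.
  rewrite [X in X ^+ 2 <= _](_ : _ = - (alpha * y i 0)) ?sqrrN//.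
  by ring.
by apply: eq_bigr => j /negbTE ji; rewrite !mxE ji.
Qed.

Lemma prox_multiplier_eq0 (c alpha : R) u y (i : 'I_m) :
  0 < alpha -> prox (fun v => c * h v) (u + alpha *: y) u ->
  u i 0 != 0 -> y i 0 = 0.
Proof.
move=> alpha0 up ui0; apply/eqP/negPn/negP => yi0.
set a := alpha * y i 0.
have a0 : a != 0 by rewrite mulf_neq0// gt_eqF.
have na0 : 0 < `|a| by rewrite normr_gt0.
have nu0 : 0 < `|u i 0| by rewrite normr_gt0.
have s0 : 0 < `|u i 0| + `|a| by rewrite addr_gt0.
pose k := `|u i 0| / (`|u i 0| + `|a|).
have k0 : 0 < k by rewrite divr_gt0.
have k1 : k < 1 by rewrite ltr_pdivrMr// mul1r ltrDl.
have kau : `|k * a| < `|u i 0|.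
  rewrite normrM (gtr0_norm k0) mulrAC ltr_pdivrMr// ltr_pM2l//.
  by rewrite ltrDr.
have := prox_coord (i := i) (t := u i 0 + k * a) up.
have -> : (0 < u i 0 + k * a) = (0 < u i 0).
  move: kau; rewrite ltr_norml => /andP[].
  case: (ltrgt0P (u i 0)) => [ui l r|ui l r|/eqP]; last by rewrite (negbTE ui0).
    by apply/idP; lra.
  by apply/negbTE; rewrite -leNgt; lra.
move=> /(_ erefl); rewrite -/a => H.
have a2 : 0 < a ^+ 2 by rewrite exprn_even_gt0.
have : (1 - k) ^+ 2 * a ^+ 2 < a ^+ 2.
  rewrite gtr_pMl// expr_lt1 ?subr_ge0 ?ltW//; lra.
rewrite ltNge => /negP; apply; apply: (le_trans H).
rewrite le_eqVlt; apply/orP; left; apply/eqP; ring.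
Qed.

Lemma prox_multiplier_ge0 (c alpha : R) u y (i : 'I_m) :
  0 < alpha -> prox (fun v => c * h v) (u + alpha *: y) u ->
  u i 0 = 0 -> 0 <= y i 0.
Proof.
move=> alpha0 up ui; rewrite leNgt; apply/negP => yi.
have ay : alpha * y i 0 < 0 by rewrite pmulr_rlt0.
have := prox_coord (i := i) (t := alpha * y i 0) up; rewrite ui.
rewrite ltxx add0r subrr expr0n /= ltNge (ltW ay) => /(_ erefl).
by rewrite leNgt exprn_even_gt0//= lt_eqF.
Qed.

Lemma h_local u : exists2 delta : R, 0 < delta & forall v, `|v - u| < delta ->
  h u + 1 <= h v \/ h u <= h v /\ forall i, u i 0 <= 0 -> v i 0 <= 0.
Proof.
exists (\big[Num.min/1]_(i | 0 < u i 0) u i 0).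
  by apply: lt_bigmin => // i.
move=> v vu.
have sub i : 0 < u i 0 -> 0 < v i 0.
  move=> ui.
  have : \big[Num.min/1]_(j | 0 < u j 0) u j 0 <= u i 0.
    by exact: bigmin_le_cond.
  move=> /(lt_le_trans vu) /(le_lt_trans (coord_le_norm _ i)).
  rewrite !mxE ltr_norml => /andP[]; lra.
have sub' : [pred i | 0 < u i 0] \subset [pred i | 0 < v i 0].
  by apply/fintype.subsetP => i; rewrite !inE; exact: sub.
rewrite !hE.
have [vu'|] := boolP ([pred i | 0 < v i 0] \subset [pred i | 0 < u i 0]).
  right; rewrite ler_nat; split; first exact: subset_leq_card.
  move=> i; rewrite leNgt [v i 0 <= 0]leNgt; apply: contra => vi.
  by move/fintype.subsetP: vu' => /(_ i); rewrite !inE; exact.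
move=> vu'; left; rewrite natr1 ler_nat.
by apply: proper_card; rewrite properE sub'.
Qed.

End ProximalMultiplier.

Theorem theorem6 (R : realType) (n m : nat) (f : 'cV[R]_n -> R) (lambda : R)
    (A : 'M[R]_(m, n)) (b : 'cV[R]_m) (xs : 'cV[R]_n) (us ys : 'cV[R]_m)
    (f_C2 : twice_continuously_differentiable f)
    (lambda_gt0 : 0 < lambda)
    (stationary : P_stationary f lambda A b xs us ys)
    (second_order : forall d : 'cV[R]_n, critical_cone A us ys d -> d != 0 ->
       0 < (d^T *m hessian f xs *m d) 0 0) :
  strict_local_solution f lambda A b (xs, us) /\
  exists deltas cs : R, [/\ 0 < deltas, 0 < cs &
    forall (x : 'cV[R]_n) (u : 'cV[R]_m),
      (pball (xs, us) deltas `&` feasible A b) (x, u) ->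
      f x + lambda * h u >=
        f xs + lambda * h us + cs * pnorm ((x, u) - (xs, us)) ^+ 2].
Proof.
case: stationary => alpha alpha0 [grad0 uprox feas].
have feas_s : A *m xs + b = us by apply/eqP; rewrite -subr_eq0 feas.
have y_eq0 i : us i 0 != 0 -> ys i 0 = 0.
  exact: prox_multiplier_eq0 alpha0 uprox.
have y_ge0 i : us i 0 = 0 -> 0 <= ys i 0.
  exact: prox_multiplier_ge0 alpha0 uprox.
suff growth : exists deltas cs : R, [/\ 0 < deltas, 0 < cs &
    forall (x : 'cV[R]_n) (u : 'cV[R]_m),
      (pball (xs, us) deltas `&` feasible A b) (x, u) ->
      f x + lambda * h u >=
        f xs + lambda * h us + cs * pnorm ((x, u) - (xs, us)) ^+ 2].
  split=> //; split=> //; have [delta [c [delta0 c0 H]]] := growth.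
  exists delta => // -[x u] xu xu_neq; apply: lt_le_trans (H _ _ xu).
  by rewrite /objective /= ltrDl mulr_gt0// exprn_gt0// pnorm_gt0// subr_eq0.
set a := gradient f xs; set H := hessian f xs.
have aE d : dot a d = - \sum_(i < m) ys i 0 * (A *m d) i 0.
  have -> : a = - (A^T *m ys) by apply/eqP; rewrite -addr_eq0 grad0.
  by rewrite /dot linearN /= trmx_mul trmxK mulNmx -mulmxA mxE -/(dot _ _) dotE.
pose K := [set d : 'cV[R]_n | forall i, us i 0 == 0 -> (A *m d) i 0 <= 0].
have term_ge0 d i : K d -> 0 <= - (ys i 0 * (A *m d) i 0).
  move=> Kd; have [ui|ui] := eqVneq (us i 0) 0.
  2: by rewrite y_eq0// mul0r oppr0.
  by rewrite oppr_ge0 mulr_ge0_le0 ?y_ge0// Kd// ui.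
have a_ge0 d : K d -> 0 <= dot a d.
  by move=> Kd; rewrite aE -sumrN sumr_ge0// => i _; exact: term_ge0.
have aH d : K d -> d != 0 -> dot a d = 0 -> 0 < dot d (H *m d).
  move=> Kd d0 ad0; rewrite /dot mulmxA; apply: second_order => //.
  have Ad0 i : ys i 0 * (A *m d) i 0 = 0.
    move/eqP: ad0; rewrite aE -sumrN psumr_eq0 => [|j _]; last exact: term_ge0.
    by move=> /allP /(_ i (mem_index_enum _)); rewrite oppr_eq0 => /eqP.
  split=> [|k].
    apply/colP => k; rewrite mul_rowsub_mx !mxE.
    have := enum_valP k; rewrite inE => /andP[_ yi].
    by have /eqP := Ad0 (enum_val k); rewrite mulf_eq0 gt_eqF//= mxE => /eqP.
  rewrite mul_rowsub_mx mxE; apply: Kd.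
  by have := enum_valP k; rewrite inE => /andP[].
have [|k d k0 Kd i ui|c [M [c0 M0 HcM]]] := cone_penalization _ _ a_ge0 aH.
- exact: polyhedral_cone_closed.
- by rewrite -scalemxAr mxE pmulr_rle0// Kd.
have [f_diff g_diff _] := f_C2.
have c40 : 0 < c / 4 by rewrite divr_gt0.
have [d1 d10 taylor] := taylor2 f_diff (g_diff xs) c40.
have [d2 d20 hloc] := h_local us.
have l20 : 0 < lambda / 2 by rewrite divr_gt0.
have /cvgrPdist_le/(_ _ l20)/nbhs_normP[d3 /= d30 f_near] :
  f x @[x --> xs] --> f xs by exact: differentiable_continuous.
have [C C0 AC] := mulmx_le_norm A.
pose L := n%:R + m%:R * C ^+ 2 + 1.
have L0 : 0 < L by rewrite ltr_wpDl// addr_ge0// mulr_ge0// sqr_ge0.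
exists (Num.min (Num.min d1 d2) (Num.min d3 (Num.min 1 (2 / M)))).
exists (Num.min (c / (4 * L)) (lambda / 2)); split.
- by rewrite !lt_min d10 d20 d30 ltr01 divr_gt0.
- by rewrite lt_min l20 divr_gt0// mulr_gt0.
move=> x u [/=]; rewrite /pball /feasible /= !lt_min.
set p := pnorm _; set d := x - xs.
have [xp up] := norm_le_pnorm ((x, u) - (xs, us)).
move=> /andP[/andP[p1 p2] /andP[p3 /andP[p4 p5]]] xu.
have Ad : u - us = A *m d.
  by rewrite -xu -feas_s mulmxBr opprD addrACA subrr addr0.
have p0 : 0 <= p := pnorm_ge0 _.
have dp : `|d| <= p := xp.
have pE : p ^+ 2 <= L * `|d| ^+ 2.
  rewrite /p sqr_pnorm /= -/d Ad.
  have := le_trans (ler_norm _) (dot_le_norm d d).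
  have := le_trans (ler_norm _) (dot_le_norm (A *m d) (A *m d)).
  have : m%:R * (`|A *m d| * `|A *m d|) <= m%:R * (C * `|d| * (C * `|d|)).
    by rewrite ler_wpM2l// ler_pM.
  have : 0 <= `|d| ^+ 2 by exact: sqr_ge0.
  rewrite /L; lra.
have cp1 : Num.min (c / (4 * L)) (lambda / 2) * p ^+ 2 <= c / 4 * `|d| ^+ 2.
  apply: (@le_trans _ _ (c / (4 * L) * (L * `|d| ^+ 2))).
    by rewrite ler_pM ?sqr_ge0// ?ge_min ?lexx// le_min !ltW// divr_gt0//
      mulr_gt0.
  rewrite le_eqVlt; apply/orP; left; apply/eqP; field.
  by rewrite gt_eqF.
have cp2 : Num.min (c / (4 * L)) (lambda / 2) * p ^+ 2 <= lambda / 2.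
  rewrite (@le_trans _ _ (lambda / 2 * p ^+ 2))//.
    by rewrite ler_wpM2r ?sqr_ge0// ge_min lexx orbT.
  by rewrite ler_piMr ?(ltW l20)// expr_le1// ltW.
have [jump|[hu uneg]] := hloc u (le_lt_trans up p2).
  have : lambda * (h us + 1) <= lambda * h u by rewrite ler_pM2l.
  have := f_near x; rewrite /= -normrN opprB => /(_ (le_lt_trans dp p3)).
  by rewrite ler_distl => /andP[]; lra.
have Kd : K d.
  move=> i /eqP ui; rewrite -Ad !mxE ui subr0; apply: uneg.
  by rewrite ui.
have hu' : lambda * h us <= lambda * h u by rewrite ler_pM2l.
have := taylor d (le_lt_trans dp p1).
rewrite [xs + d]addrC subrK -/a -/H ler_norml => /andP[Hlow _].
have := HcM d Kd.
have : M * `|d| * dot a d <= 2 * dot a d.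
  rewrite ler_wpM2r ?a_ge0// mulrC -ler_pdivlMr//.
  exact: le_trans dp (ltW p5).
lra.
Qed.
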